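(* Let $\tau\in S_k$. Then $\mathcal{G}=\{(x,y)\in[0,1]^2: r^\downarrow(x)\leq y\leq r^\uparrow(x)\}$.
   Context: $S_n(\tau)$ is the set of permutations of $[n]$ avoiding $\tau$; $L(\tau)=\lim_{n\to\infty}|S_n(\tau)|^{1/n}$. $S_n(\tau;\sigma_I=J)$ is the set of $\sigma\in S_n(\tau)$ with $\sigma_I=J$. The rare region $\mathcal{R}$ is the set of $(x,y)\in[0,1]^2$ such that for every sequence $(I_n,J_n)\in[n]^2$ with $(I_n/n,J_n/n)\to(x,y)$ one has $\limsup_{n\to\infty}|S_n(\tau;\sigma_{I_n}=J_n)|^{1/n}<L(\tau)$. The good region is $\mathcal{G}=[0,1]^2\setminus\mathcal{R}$. For $x\in[0,1]$, $r^\uparrow(x)=\sup\{y:(x,y)\in\mathcal{G}\}$ and $r^\downarrow(x)=\inf\{y:(x,y)\in\mathcal{G}\}$. *)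

(* Defs.v *)
From mathcomp Require Export all_boot all_order all_algebra perm.
From mathcomp Require Export all_classical all_reals all_analysis.

Set Implicit Arguments.
Unset Strict Implicit.
Unset Printing Implicit Defensive.

Import Order.TTheory GRing.Theory Num.Theory.
Import numFieldNormedType.Exports.

Local Open Scope classical_set_scope.
Local Open Scope ring_scope.

Definition contains_pattern (k n : nat) (tau : 'S_k) (sigma : 'S_n) : bool :=
  [exists f : {ffun 'I_k -> 'I_n},
     [forall a : 'I_k, forall b : 'I_k, ((a < b)%N ==> (f a < f b)%N)] &&
     [forall a : 'I_k, forall b : 'I_k,
        (sigma (f a) < sigma (f b))%N == (tau a < tau b)%N]].

Definition avoiders (k : nat) (tau : 'S_k) (n : nat) : {set 'S_n} :=
  [set sigma : 'S_n | ~~ contains_pattern tau sigma]%SET.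

(* 'S_n permutes {0, ..., n-1}, whereas [i] and [j] are 1-based, as in
   "sigma_i = j" with i, j in {1, ..., n}. *)
Definition avoiders_at (k : nat) (tau : 'S_k) (n i j : nat) : {set 'S_n} :=
  [set sigma in avoiders tau n |
     [exists a : 'I_n, (a.+1 == i) && ((sigma a).+1 == j)]]%SET.

Section Regions.
Variable R : realType.

Definition card_root (n m : nat) : R := m%:R `^ n%:R^-1.

(* The limit is taken in the extended reals, so that it agrees with the real
   limit whenever the latter exists, and exists by supermultiplicativity. *)
Definition growth_rate (k : nat) (tau : 'S_k) : \bar R :=
  limn (fun n => (card_root n #|avoiders tau n|)%:E).

Definition unit_square : set (R * R) := `[0, 1] `*` `[0, 1].

Definition rare_region (k : nat) (tau : 'S_k) : set (R * R) :=
  [set p | unit_square p /\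
     forall I J : nat -> nat,
       (forall n, (0 < n)%N -> (1 <= I n <= n)%N /\ (1 <= J n <= n)%N) ->
       (fun n => ((I n)%:R / n%:R, (J n)%:R / n%:R) : R * R) @ \oo --> p ->
       (limn_esup (fun n => (card_root n #|avoiders_at tau n (I n) (J n)|)%:E)
          < growth_rate tau)%E].

Definition good_region (k : nat) (tau : 'S_k) : set (R * R) :=
  unit_square `\` rare_region tau.

Definition r_up (k : nat) (tau : 'S_k) (x : R) : R :=
  sup [set y | good_region tau (x, y)].

Definition r_down (k : nat) (tau : 'S_k) (x : R) : R :=
  inf [set y | good_region tau (x, y)].

End Regions.

(* Main.v *)
Require Import Defs.
From mathcomp Require Import zify ring lra.

(** A permutation cannot be decomposable both as a direct and as a skew sum
    (compare its first and last entries), so, up to the reflection [y -> 1 - y],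
    [tau] is sum-indecomposable and its avoiders are closed under direct sums.
    Hence [|S_n(tau)|] is supermultiplicative, and [L(tau)] is the supremum of the
    roots.  Padding an avoider through [(x, y)] by direct summands of suitable sizes
    loses no exponential growth, so with any point [p] the good region contains the
    triangle with vertices [(0, 0)], [(1, 1)] and [p].  In particular every vertical
    fibre is star-shaped about its diagonal point; being closed, it is a segment. *)

Set Implicit Arguments.
Unset Strict Implicit.
Unset Printing Implicit Defensive.

(** * Direct sums and complements of avoiders *)

Section DirectSum.
Variables m n : nat.
Implicit Types (s : 'S_m) (t : 'S_n).

Definition dsum_fun s t (i : 'I_(m + n)) : 'I_(m + n) :=
  match fintype.split i with
  | inl a => lshift n (s a)
  | inr b => rshift m (t b)
  end.

Lemma dsum_fun_lshift s t a : dsum_fun s t (lshift n a) = lshift n (s a).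
Proof. by rewrite /dsum_fun (unsplitK (inl a)). Qed.

Lemma dsum_fun_rshift s t b : dsum_fun s t (rshift m b) = rshift m (t b).
Proof. by rewrite /dsum_fun (unsplitK (inr b)). Qed.

Lemma dsum_fun_inj s t : injective (dsum_fun s t).
Proof.
move=> i j; case: (split_ordP i) => a ->; case: (split_ordP j) => b ->;
  rewrite ?dsum_fun_lshift ?dsum_fun_rshift => /(congr1 val) /= e.
- by have /perm_inj -> : s a = s b by exact: val_inj.
- by have := ltn_ord (s a); lia.
- by have := ltn_ord (s b); lia.
- by have /perm_inj -> : t a = t b by apply: val_inj; move: e => /=; lia.
Qed.

Definition dsum s t : 'S_(m + n) := perm (@dsum_fun_inj s t).

Lemma dsum_lshift s t a : dsum s t (lshift n a) = lshift n (s a).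
Proof. by rewrite permE dsum_fun_lshift. Qed.

Lemma dsum_rshift s t b : dsum s t (rshift m b) = rshift m (t b).
Proof. by rewrite permE dsum_fun_rshift. Qed.

Lemma dsum_inj : injective (fun st : 'S_m * 'S_n => dsum st.1 st.2).
Proof.
move=> [s t] [s' t'] /= e; congr pair; apply/permP => i; apply: val_inj.
- by have /(congr1 val) := congr1 (fun u : 'S__ => u (lshift n i)) e;
    rewrite !dsum_lshift.
- have /(congr1 val) := congr1 (fun u : 'S__ => u (rshift m i)) e.
  by rewrite !dsum_rshift /=; lia.
Qed.

End DirectSum.

(** A cut [i] crossed by no inversion has its first [i] entries all below the rest, which makes
    [tau] a direct sum of sizes [i] and [k - i]. *)
Definition sum_indecomposable (k : nat) (tau : 'S_k) : Prop :=
  forall i, 0 < i < k -> exists a b : 'I_k, [/\ a < i, i <= b & tau b < tau a].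

Lemma contains_patternP (k n : nat) (tau : 'S_k) (sigma : 'S_n) :
  reflect (exists f : 'I_k -> 'I_n,
             (forall a b : 'I_k, a < b -> f a < f b) /\
             forall a b : 'I_k, (sigma (f a) < sigma (f b)) = (tau a < tau b))
          (contains_pattern tau sigma).
Proof.
apply: (iffP existsP) => [[f /andP[/forallP hf /forallP ht]]|[f [hf ht]]].
- exists f; split => a b; first by move/forallP: (hf a) => /(_ b)/implyP.
  by move/forallP: (ht a) => /(_ b)/eqP.
- exists [ffun a => f a]; apply/andP; split; apply/forallP => a;
    apply/forallP => b; rewrite !ffunE; first exact/implyP/hf.
  by rewrite ht.
Qed.

(** Meant for the pattern positions that an occurrence sends into the first summand: they form a
    prefix, and its length is the cut to test for an inversion. *)
Lemma initial_segment (k : nat) (P : pred 'I_k) :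
  (forall a b : 'I_k, a < b -> P b -> P a) ->
  exists2 i, i <= k & forall a : 'I_k, P a = (a < i).
Proof.
elim: k P => [|k IH] P hP; first by exists 0 => // -[].
have [|i ik hi] := IH (fun a => P (widen_ord (leqnSn k) a)).
  by move=> a b ab; apply: hP.
have Pw (a : 'I_k.+1) : a < k -> P a = (a < i).
  by move=> ak; rewrite -(hi (Ordinal ak)); congr P; apply: val_inj.
have [Pk|nPk] := boolP (P ord_max).
  exists k.+1 => // a; rewrite ltn_ord.
  have [ak|ka] := ltnP a k; first exact: (hP a ord_max).
  by rewrite (_ : a = ord_max) //; apply: val_inj => /=; have := ltn_ord a; lia.
exists i; first lia.
move=> a; have [ak|ka] := ltnP a k; first exact: Pw.
rewrite (_ : a = ord_max); last by apply: val_inj => /=; have := ltn_ord a; lia.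
by rewrite (negbTE nPk) /=; lia.
Qed.

(** An occurrence of [tau] either lies inside one summand or splits [tau] at a proper cut. That cut
    is crossed by an inversion, whereas the first summand lies entirely below the second. *)
Lemma dsum_avoiders (k m n : nat) (tau : 'S_k) (s : 'S_m) (t : 'S_n) :
  sum_indecomposable tau ->
  s \in avoiders tau m -> t \in avoiders tau n -> dsum s t \in avoiders tau (m + n).
Proof.
move=> ind; rewrite !inE => hs ht; apply/negP => /contains_patternP[f [f_inc f_pat]].
have [a b ab fb|i ik hi] := @initial_segment k (fun a => f a < m).
  exact: ltn_trans (f_inc _ _ ab) fb.
have small (a : 'I_k) : a < i -> {c | f a = lshift n c}.
  by rewrite -hi => fa; exists (Ordinal fa); apply: val_inj.
have big (a : 'I_k) : i <= a -> {c | f a = rshift m c}.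
  rewrite leqNgt -hi -leqNgt => fa.
  have fan : f a - m < n by have := ltn_ord (f a); lia.
  by exists (Ordinal fan); apply: val_inj => /=; lia.
have [i0|i_gt0] := posnP i.
  have all_big (a : 'I_k) : i <= a by lia.
  case/negP: ht; apply/contains_patternP.
  exists (fun a => sval (big a (all_big a))); split => a b.
    by move/f_inc; case: (big a _) => c /= ->; case: (big b _) => d /= -> /=; lia.
  rewrite -f_pat; case: (big a _) => c /= ->; case: (big b _) => d /= ->.
  by rewrite !dsum_rshift /=; lia.
have [ki|ik'] := leqP k i.
  have all_small (a : 'I_k) : a < i by exact: leq_trans (ltn_ord a) ki.
  case/negP: hs; apply/contains_patternP.
  exists (fun a => sval (small a (all_small a))); split => a b.
    by move/f_inc; case: (small a _) => c /= ->; case: (small b _) => d /= ->.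
  rewrite -f_pat; case: (small a _) => c /= ->; case: (small b _) => d /= ->.
  by rewrite !dsum_lshift.
have [|a [b [ai ib]]] := ind i; first by rewrite i_gt0.
rewrite -f_pat; have [c ->] := small a ai; have [d ->] := big b ib.
by rewrite dsum_lshift dsum_rshift /=; have := ltn_ord (s c); lia.
Qed.

Lemma avoiders_atP (k : nat) (tau : 'S_k) (n i j : nat) (sigma : 'S_n) :
  reflect (sigma \in avoiders tau n /\
           exists a : 'I_n, a.+1 = i /\ (sigma a).+1 = j)
          (sigma \in avoiders_at tau n i j).
Proof.
rewrite [X in reflect _ X]finset.in_set; apply: (iffP andP) => -[h].
  by move/existsP => [a /andP[/eqP ai /eqP aj]]; split => //; exists a.
by move=> [a [ai aj]]; split => //; apply/existsP; exists a; rewrite ai aj !eqxx.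
Qed.

Lemma leq_card_dsum (m n : nat) (A : {set 'S_m}) (B : {set 'S_n})
    (D : {set 'S_(m + n)}) :
  (forall s t, s \in A -> t \in B -> dsum s t \in D) -> #|A| * #|B| <= #|D|.
Proof.
move=> h; rewrite -cardsX -(card_imset (finset.setX A B) (@dsum_inj m n)).
apply/subset_leq_card/fintype.subsetP => u /imsetP[[s t]].
by rewrite inE /= => /andP[sA tB] ->; exact: h.
Qed.

Section SumIndecomposable.
Variables (k : nat) (tau : 'S_k).
Hypothesis ind : sum_indecomposable tau.

Lemma card_avoidersD (m n : nat) :
  #|avoiders tau m| * #|avoiders tau n| <= #|avoiders tau (m + n)|.
Proof. by apply: leq_card_dsum => s t; exact: dsum_avoiders. Qed.

Lemma card_avoiders_atDr (m n i j : nat) :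
  #|avoiders_at tau m i j| * #|avoiders tau n| <= #|avoiders_at tau (m + n) i j|.
Proof.
apply: leq_card_dsum => s t /avoiders_atP[hs [a [ai aj]]] ht.
apply/avoiders_atP; split; first exact: dsum_avoiders.
by exists (lshift n a); rewrite dsum_lshift.
Qed.

Lemma card_avoiders_atDl (m n i j : nat) :
  #|avoiders tau m| * #|avoiders_at tau n i j| <=
  #|avoiders_at tau (m + n) (m + i) (m + j)|.
Proof.
apply: leq_card_dsum => s t hs /avoiders_atP[ht [a [ai aj]]].
apply/avoiders_atP; split; first exact: dsum_avoiders.
by exists (rshift m a); rewrite dsum_rshift /= -ai -aj !addnS.
Qed.

Hypothesis k_gt1 : 1 < k.

Lemma avoiders_small (n : nat) (s : 'S_n) : n < 2 -> s \in avoiders tau n.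
Proof.
move=> n2; rewrite inE; apply/negP => /contains_patternP[f [f_inc _]].
have := f_inc (Ordinal (ltnW k_gt1)) (Ordinal k_gt1) isT.
by case: (f _) => ? /=; case: (f _) => ? /=; lia.
Qed.

Lemma card_avoiders_gt0 (n : nat) : 0 < #|avoiders tau n|.
Proof.
have small (p : nat) : p < 2 -> 0 < #|avoiders tau p|.
  by move=> p2; apply/card_gt0P; exists 1%g; exact: avoiders_small.
elim: n => [|n IH]; first exact: small.
by rewrite -[n.+1]addn1; apply: leq_trans (card_avoidersD n 1); rewrite muln_gt0 IH small.
Qed.

(** A single point is inserted between the two avoiders as a middle summand of size 1. *)
Lemma card_avoiders_at_diag (m n : nat) :
  #|avoiders tau m| * #|avoiders tau n| <=
  #|avoiders_at tau (m + 1 + n) m.+1 m.+1|.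
Proof.
apply: leq_trans (card_avoiders_atDr _ _ _ _).
rewrite leq_mul2r -[X in avoiders_at _ _ X X]addn1; apply/orP; right.
apply: leq_trans (card_avoiders_atDl _ _ _ _).
rewrite -[X in X <= _]muln1 leq_mul2l; apply/orP; right.
apply/card_gt0P; exists 1%g; apply/avoiders_atP; split; first exact: avoiders_small.
by exists ord0; rewrite perm1.
Qed.

End SumIndecomposable.

(** * Reflection of values *)

Section Complement.
Variable n : nat.
Implicit Types s : 'S_n.

Definition perm_compl s : 'S_n := perm (inj_comp (@rev_ord_inj n) (@perm_inj _ s)).

Lemma perm_complE s a : perm_compl s a = rev_ord (s a).
Proof. by rewrite permE. Qed.

Lemma perm_complK : involutive perm_compl.
Proof. by move=> s; apply/permP => a; rewrite !perm_complE rev_ordK. Qed.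

Lemma ltn_perm_compl s a b : (perm_compl s a < perm_compl s b) = (s b < s a).
Proof.
by rewrite !perm_complE /=; have := ltn_ord (s a); have := ltn_ord (s b); lia.
Qed.

End Complement.

Lemma avoiders_compl (k n : nat) (tau : 'S_k) (s : 'S_n) :
  (perm_compl s \in avoiders (perm_compl tau) n) = (s \in avoiders tau n).
Proof.
rewrite !inE; congr (~~ _); apply/contains_patternP/contains_patternP => -[f [fi fp]];
  exists f; split => // a b; first by rewrite -ltn_perm_compl fp ltn_perm_compl.
by rewrite !ltn_perm_compl.
Qed.

Lemma card_avoiders_compl (k n : nat) (tau : 'S_k) :
  #|avoiders (perm_compl tau) n| = #|avoiders tau n|.
Proof.
rewrite -(card_imset (avoiders tau n) (can_inj (@perm_complK n))).
apply: eq_card => s; rewrite -[s]perm_complK avoiders_compl.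
by rewrite (mem_imset _ _ (can_inj (@perm_complK n))).
Qed.

Lemma card_avoiders_at_compl (k n i j : nat) (tau : 'S_k) : 0 < j <= n ->
  #|avoiders_at (perm_compl tau) n i (n.+1 - j)| = #|avoiders_at tau n i j|.
Proof.
move=> jn; rewrite -(card_imset (avoiders_at tau n i j) (can_inj (@perm_complK n))).
apply: eq_card => s; rewrite -[s]perm_complK.
rewrite (mem_imset _ _ (can_inj (@perm_complK n))); move: {s}(perm_compl s) => s.
apply/avoiders_atP/avoiders_atP; rewrite avoiders_compl => -[hs [a [ai aj]]];
  split => //; exists a; split => //; move: aj; rewrite perm_complE /=;
  by have := ltn_ord (s a); lia.
Qed.

(** A cut of [tau] without inversion puts the first entry below the last; in the complement this one
    pair is an inversion across every cut. *)
Lemma sum_indecomposable_dichotomy (k : nat) (tau : 'S_k) :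
  sum_indecomposable tau \/ sum_indecomposable (perm_compl tau).
Proof.
have [//|] := pselect (sum_indecomposable tau); first by left.
move=> nind; right => j /andP[j0 jk].
apply: contrapT => nj; apply: nind => i /andP[i0 ik].
apply: contrapT => ni.
have k0 : 0 < k by lia.
have k1 : k.-1 < k by lia.
have tau_lt : ~ tau (Ordinal k1) < tau (Ordinal k0).
  by move=> h; apply: ni; exists (Ordinal k0), (Ordinal k1); split => //=; lia.
apply: nj; exists (Ordinal k0), (Ordinal k1); split => //=; first lia.
rewrite ltn_perm_compl ltn_neqAle leqNgt; apply/andP; split; last exact/negP.
by rewrite (inj_eq val_inj) (inj_eq perm_inj) -(inj_eq val_inj) /=; lia.
Qed.

Import Order.TTheory GRing.Theory Num.Theory.
Import numFieldNormedType.Exports.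

Local Open Scope classical_set_scope.
Local Open Scope ring_scope.

(** * Real thresholds and limits superior in the extended reals *)

Section ExtendedReals.
Variable R : realType.
Local Open Scope ereal_scope.

Lemma ereal_real_between (c : R) (x : \bar R) :
  c%:E < x -> exists2 d : R, (c < d)%R & d%:E < x.
Proof.
case: x => [r||] //; last by exists (c + 1)%R; rewrite ?ltry //; lra.
rewrite lte_fin => cr; exists ((c + r) / 2)%R; rewrite ?lte_fin; lra.
Qed.

Lemma lee_of_real_lt (x y : \bar R) :
  (forall c : R, c%:E < x -> c%:E <= y) -> x <= y.
Proof.
move=> h; rewrite leNgt; apply/negP => yx.
have [z yz zx] : exists2 z : R, y < z%:E & z%:E < x.
  case: y yx {h} => [r /ereal_real_between[d rd dx]||].
  - by exists d.
  - by rewrite ltNge leey.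
  - case: x => [s _||] //; last by exists 0%R; rewrite ?ltNyr ?ltry.
    by exists (s - 1)%R; rewrite ?ltNyr // lte_fin; lra.
by have := lt_le_trans yz (h _ zx); rewrite ltxx.
Qed.

(** Supplies the thresholds of the diagonal argument, with [x] the growth rate; for [x = +oo] the
    sequence of natural numbers serves. *)
Lemma ereal_real_seq (x : \bar R) : -oo < x -> exists u : nat -> R,
  (forall m, (u m)%:E < x) /\
  forall c : R, c%:E < x -> exists M, forall m, (M <= m)%N -> (c <= u m)%R.
Proof.
case: x => [r _||] //.
- exists (fun m => r - m.+1%:R^-1)%R; split => [m|c].
    by rewrite lte_fin gtrBl.
  rewrite lte_fin => cr; have e0 : (0 < r - c)%R by rewrite subr_gt0.
  have [M _ hM] := near_infty_natSinv_lt (PosNum e0).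
  exists M => m /hM h; have {}h : (m.+1%:R^-1 < r - c)%R := h.
  by rewrite lerBrDr -lerBrDl ltW.
- move=> _; exists (fun m => m%:R); split => [m|c _]; first exact: ltry.
  by have [M _ hM] := nbhs_infty_ger c; exists M.
Qed.

Lemma limn_esup_le_near (u : nat -> \bar R) (l : \bar R) :
  (\forall n \near \oo, u n <= l) -> limn_esup u <= l.
Proof.
move=> h; apply: (@le_trans _ _ (ereal_sup (u @` [set n | u n <= l]))).
  by apply: ereal_inf_lbound; exists [set n | u n <= l].
by apply: ge_ereal_sup => _ [n /= hn <-].
Qed.

Lemma limn_esup_ge (u : nat -> \bar R) (l : \bar R) :
  (forall N, exists2 n, (N <= n)%N & l <= u n) -> l <= limn_esup u.
Proof.
move=> h; apply: le_ereal_inf_tmp => _ [V [N _ NV] <-].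
have [n Nn ln] := h N; apply: (le_trans ln); apply: ereal_sup_ubound.
by exists n => //; exact: NV.
Qed.

End ExtendedReals.

(** * Supermultiplicative sequences *)

Section Supermultiplicative.
Variable R : realType.

Lemma card_root_ge0 (n m : nat) : 0 <= card_root R n m.
Proof. exact: powR_ge0. Qed.

Lemma card_root_geE (c : R) (n m : nat) : 0 <= c -> (0 < n)%N ->
  (c <= card_root R n m) = (c ^+ n <= m%:R).
Proof.
move=> c0 n0; have -> : m%:R = card_root R n m ^+ n :> R.
  rewrite -powR_mulrn ?card_root_ge0 // -powRrM mulVf ?powRr1 //.
  by rewrite pnatr_eq0 -lt0n.
by rewrite ler_pXn2r // nnegrE card_root_ge0.
Qed.

(** Constant factors cost no exponential rate: the gap between [c] and [d] absorbs them. *)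
Lemma geometric_dominated (c d C : R) : 0 <= c < d ->
  \forall n \near \oo, C * c ^+ n <= d ^+ n.
Proof.
move=> /andP[c0 cd]; have d0 : 0 < d by lra.
have z1 : `|c / d| < 1.
  by rewrite ger0_norm ?divr_ge0 ?(ltW d0) // ltr_pdivrMr // mul1r.
have C0 : 0 < `|C| + 1 by rewrite ltr_wpDl.
have e0 : 0 < (`|C| + 1)^-1 by rewrite invr_gt0.
move/cvgrPdist_le/(_ _ e0): (cvg_expr z1); apply: filterS => n.
rewrite sub0r normrN ger0_norm ?exprn_ge0 ?divr_ge0 ?(ltW d0) // => h.
have -> : C * c ^+ n = C * (c / d) ^+ n * d ^+ n.
  by rewrite -mulrA -exprMn divfK // gt_eqF.
rewrite ler_piMl ?exprn_ge0 ?(ltW d0) //.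
apply: (@le_trans _ _ ((`|C| + 1) * (c / d) ^+ n)).
  rewrite ler_wpM2r ?exprn_ge0 ?divr_ge0 ?(ltW d0) //.
  by have := ler_norm C; lra.
by rewrite mulrC -ler_pdivlMr // div1r.
Qed.

Variable a : nat -> nat.
Hypothesis a_gt0 : forall n, (0 < a n)%N.
Hypothesis aD : forall m n, (a m * a n <= a (m + n))%N.

Lemma supermultiplicative_exp (m q : nat) : (a m ^ q <= a (q * m))%N.
Proof.
elim: q => [|q IH]; first by rewrite mul0n a_gt0.
by rewrite expnS mulSn (leq_trans _ (aD _ _)) // leq_mul2l IH orbT.
Qed.

(** Divide [n] by [m]: the full blocks of length [m] supply the powers of [c], and the remainder,
    shorter than [m], costs at most [d ^+ m] with [d = max 1 c]. *)
Lemma supermultiplicative_geometric (c : R) (m : nat) : 0 <= c -> (0 < m)%N ->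
  c ^+ m <= (a m)%:R -> exists2 C : R, 0 < C & forall n, c ^+ n <= C * (a n)%:R.
Proof.
move=> c0 m0 cm; set d := Num.max 1 c.
have d1 : 1 <= d by rewrite le_max lexx.
have d0 : 0 < d by lra.
exists (d ^+ m) => [|n]; first exact: exprn_gt0.
rewrite {1}(divn_eq n m) exprD mulrC ler_pM ?exprn_ge0 //.
  apply: (@le_trans _ _ (d ^+ (n %% m))).
    by rewrite lerXn2r ?nnegrE ?(ltW d0) // le_max lexx orbT.
  by rewrite ler_weXn2l // ltnW // ltn_mod.
rewrite mulnC exprM (@le_trans _ _ ((a m)%:R ^+ (n %/ m))) //.
  by rewrite lerXn2r ?nnegrE ?exprn_ge0 ?ler0n.
rewrite -natrX ler_nat (leq_trans (supermultiplicative_exp _ _)) //.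
rewrite {2}(divn_eq n m) (leq_trans _ (aD _ _)) // leq_pmulr //.
Qed.

Let root (n : nat) : \bar R := (card_root R n (a n))%:E.
Let sup_root : \bar R := ereal_sup (root @` [set n | (0 < n)%N]).

Let lt_sup_root_geometric (c : R) : 0 <= c -> (c%:E < sup_root)%E ->
  exists2 C : R, 0 < C & forall n, c ^+ n <= C * (a n)%:R.
Proof.
move=> c0 /ereal_sup_gt[_ [m /= m0 <-]]; rewrite lte_fin => /ltW.
by rewrite card_root_geE // => /(supermultiplicative_geometric c0 m0).
Qed.

Let near_root_ge (c : R) : (c%:E < sup_root)%E ->
  \forall n \near \oo, (c%:E <= root n)%E.
Proof.
move=> cS; have [c0|c0] := leP 0 c; last first.
  by near=> n; rewrite lee_fin (le_trans (ltW c0)) // card_root_ge0.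
have [d cd dS] := ereal_real_between cS.
have [C C0 hC] := lt_sup_root_geometric (le_trans c0 (ltW cd)) dS.
have cd' : 0 <= c < d by rewrite c0.
near=> n; rewrite lee_fin card_root_geE //; last by near: n; exact: nbhs_infty_gt.
rewrite -(ler_pM2l C0) (le_trans _ (hC n)) //.
by near: n; exact: geometric_dominated.
Unshelve. all: by end_near. Qed.

(** Fekete's lemma: no root of positive index exceeds the supremum, and almost all roots reach any
    given real below it. *)
Let cvg_root : root @ \oo --> sup_root.
Proof.
have ub n : (0 < n)%N -> (root n <= sup_root)%E.
  by move=> n0; apply: ereal_sup_ubound; exists n.
case E : sup_root near_root_ge ub => [s||] hge hub.
- apply/fine_cvgP; split; first by near=> n.
  apply/cvgrPdist_le => e e0; near=> n.
  have : (root n <= s%:E)%E by apply: hub; near: n; exact: nbhs_infty_gt.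
  have : ((s - e)%:E <= root n)%E.
    near: n; apply: hge; rewrite lte_fin; lra.
  rewrite /root /= !lee_fin ler_norml => h1 h2; apply/andP; split; lra.
- by apply/cvgeyPge => A; apply: hge; rewrite ltry.
- by have := hub 1%N isT; rewrite leNgt ltNyr.
Unshelve. all: by end_near. Qed.

(** The bound is uniform in [n], with [n = 0] included, so that it applies to padding blocks of any
    size. *)
Lemma lt_lim_root_geometric (c : R) : 0 <= c ->
  (c%:E < limn (fun n => (card_root R n (a n))%:E))%E ->
  exists2 C : R, 0 < C & forall n, c ^+ n <= C * (a n)%:R.
Proof.
by move=> c0; rewrite (cvg_lim _ cvg_root) //; exact: lt_sup_root_geometric.
Qed.

Lemma lim_root_ge1 : (1 <= limn (fun n => (card_root R n (a n))%:E))%E.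
Proof.
rewrite (cvg_lim _ cvg_root) //; apply: (@le_trans _ _ (root 1)).
  by rewrite lee_fin card_root_geE // expr1n ler1n.
by apply: ereal_sup_ubound; exists 1%N.
Qed.

End Supermultiplicative.

(** * The good region *)

Section GrowthRate.
Variable R : realType.

Lemma card_avoiders_trivial (k n : nat) (tau : 'S_k) : (k <= 1)%N -> (0 < n)%N ->
  #|avoiders tau n| = 0%N.
Proof.
move=> k1 n0; apply: eq_card0 => s; rewrite !inE; apply/negbTE; rewrite negbK.
apply/contains_patternP; exists (fun=> Ordinal n0); split => a b.
  by have := ltn_ord a; have := ltn_ord b; lia.
have -> : a = b by apply: val_inj => /=; have := ltn_ord a; have := ltn_ord b; lia.
by rewrite !ltnn.
Qed.

Lemma growth_rate_trivial (k : nat) (tau : 'S_k) : (k <= 1)%N ->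
  growth_rate R tau = 0%E.
Proof.
move=> k1; apply: lim_near_cst => //.
(* At [n = 0] the exponent [0^-1] is 0 and the root is 1, so the sequence vanishes only for positive
   [n]. *)
near=> n; have n0 : (0 < n)%N by near: n; exact: nbhs_infty_gt.
rewrite card_avoiders_trivial // /card_root powR0 //.
by rewrite invr_eq0 pnatr_eq0 -lt0n.
Unshelve. all: by end_near. Qed.

Lemma growth_rate_compl (k : nat) (tau : 'S_k) :
  growth_rate R (perm_compl tau) = growth_rate R tau.
Proof.
have e : (fun n => (card_root R n #|avoiders (perm_compl tau) n|)%:E) =
         (fun n => (card_root R n #|avoiders tau n|)%:E).
  by apply/funext => n; rewrite card_avoiders_compl.
exact: (congr1 (fun u : nat -> \bar R => limn u) e).
Qed.

Lemma growth_rate_ge1 (k : nat) (tau : 'S_k) : (1 < k)%N ->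
  (1 <= growth_rate R tau)%E.
Proof.
move=> k1; case: (sum_indecomposable_dichotomy tau) => ind; last first.
  rewrite -growth_rate_compl.
  by apply: lim_root_ge1; [exact: card_avoiders_gt0 | exact: card_avoidersD].
by apply: lim_root_ge1; [exact: card_avoiders_gt0 | exact: card_avoidersD].
Qed.

Lemma growth_rate_ge0 (k : nat) (tau : 'S_k) : (0 <= growth_rate R tau)%E.
Proof.
have [k1|k1] := leqP k 1; first by rewrite growth_rate_trivial.
by apply: le_trans (growth_rate_ge1 tau k1); rewrite lee_fin.
Qed.

End GrowthRate.

Section GoodRegion.
Variable R : realType.

Lemma nat_floor (z : R) : 0 <= z -> exists2 m : nat, m%:R <= z & z < m%:R + 1.
Proof.
by move=> z0; exists (Num.trunc z); rewrite ?natr1; case/andP: (truncn_itv z0).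
Qed.

Lemma grid_approx (x : R) (n : nat) : 0 <= x <= 1 -> (0 < n)%N ->
  exists2 i : nat, (1 <= i <= n)%N & `|i%:R / n%:R - x| <= n%:R^-1.
Proof.
move=> /andP[x0 x1] n0; have n0' : 0 < n%:R :> R by rewrite ltr0n.
have xn0 : 0 <= x * n%:R by rewrite mulr_ge0.
have dist i : `|i%:R - x * n%:R| <= 1 -> `|i%:R / n%:R - x| <= n%:R^-1.
  move=> h; have -> : i%:R / n%:R - x = (i%:R - x * n%:R) / n%:R.
    by rewrite mulrBl mulfK // gt_eqF.
  by rewrite normrM normfV normr_nat ler_piMl // invr_ge0.
have [t t1 t2] := nat_floor xn0.
(* Indices are 1-based, so a floor equal to 0 is replaced by 1; the error stays within one grid
   step. *)
have [t0|t0] := posnP t.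
  exists 1%N; first by rewrite n0.
  by apply: dist; rewrite t0 in t1 t2; rewrite ler_norml; apply/andP; split; lra.
exists t; last by apply: dist; rewrite ler_norml; apply/andP; split; lra.
rewrite t0 -(ler_nat R) (le_trans t1) // -[leRHS]mul1r ler_wpM2r //.
Qed.

(** * Equivalence of goodness and abundance *)

Section Abundance.
Variables (k : nat) (tau : 'S_k).

(* A form of membership in the good region that is visibly closed in [p]; the
   limit superior along one sequence is recovered by a diagonal argument. *)
Definition abundant (p : R * R) : Prop :=
  forall (eps c : R) (N : nat), 0 < eps -> (c%:E < growth_rate R tau)%E ->
  exists n i j : nat,
    [/\ (N <= n)%N, (1 <= i <= n)%N /\ (1 <= j <= n)%N,
        `|i%:R / n%:R - p.1| <= eps, `|j%:R / n%:R - p.2| <= eps &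
        c <= card_root R n #|avoiders_at tau n i j|].

(** If no triple beyond [N] within [eps] of [p] reached [c], then along every sequence tending to
    [p] the roots would eventually stay below [c], and [p] would be rare. *)
Lemma good_abundant (p : R * R) : good_region tau p -> abundant p.
Proof.
move=> [sq nrare] eps c N e0 cL; apply: contrapT => nex; apply: nrare; split => //.
move=> I J IJ cvIJ; apply: le_lt_trans cL.
have [cvI cvJ] : (fun n => (I n)%:R / n%:R : R) @ \oo --> p.1 /\
                 (fun n => (J n)%:R / n%:R : R) @ \oo --> p.2.
  by split; [exact: (cvg_comp _ _ cvIJ (@cvg_fst _ _ _ _ _))
            |exact: (cvg_comp _ _ cvIJ (@cvg_snd _ _ _ _ _))].
apply: limn_esup_le_near; near=> n; rewrite lee_fin leNgt; apply/negP => /ltW h.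
have n0 : (0 < n)%N by near: n; exact: nbhs_infty_gt.
apply: nex; exists n, (I n), (J n); split => //.
- by near: n; exact: nbhs_infty_ge.
- exact: IJ.
- by rewrite distrC; near: n; move/cvgrPdist_le: cvI; exact.
- by rewrite distrC; near: n; move/cvgrPdist_le: cvJ; exact.
Unshelve. all: by end_near. Qed.

(** Indices below [M] produce only finitely many values, so a large value of [g] can only come from
    large indices, even when [g] repeats values. *)
Lemma near_index_ge (g : nat -> nat) (M : nat) :
  \forall n \near \oo, forall m, g m = n -> (M <= m)%N.
Proof.
exists (\max_(m < M) (g m).+1)%N => // n /= hn m gm.
rewrite leqNgt; apply/negP => mM.
by have := leq_bigmax (F := fun m : 'I_M => (g m).+1) (Ordinal mM) => /=; lia.
Qed.

(** For each [m] abundance gives a triple of precision [1 / (m + 1)] whose root is at least [u m].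
    The sequence uses such a triple at each size of the form [g m], and a grid approximation of [p]
    at all other sizes. *)
Lemma abundant_good (p : R * R) : unit_square p -> abundant p -> good_region tau p.
Proof.
move=> sq ab; split => // -[_ rare].
have [u [uL uc]] := ereal_real_seq (lt_le_trans (ltNyr _) (growth_rate_ge0 R tau)).
pose close m (t : nat * nat * nat) := let: (n, i, j) := t in
  [/\ (m <= n)%N, (1 <= i <= n)%N /\ (1 <= j <= n)%N,
      `|i%:R / n%:R - p.1| <= m.+1%:R^-1, `|j%:R / n%:R - p.2| <= m.+1%:R^-1 &
      u m <= card_root R n #|avoiders_at tau n i j|].
have /choice[t ht] m : exists t, close m t.
  have [|n [i [j h]]] := ab (m.+1%:R^-1) (u m) m _ (uL m); first by rewrite invr_gt0.
  by exists (n, i, j).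
pose g m := (t m).1.1.
have gm m : (m <= g m)%N by rewrite /g; case: (t m) (ht m) => -[n i] j [].
(* Several [m] may share the size [n]; any one of them will do. The guard is there because no valid
   pair exists at [n = 0]. *)
pose fits n (q : nat * nat) := (0 < n)%N ->
  [/\ (1 <= q.1 <= n)%N /\ (1 <= q.2 <= n)%N &
   (exists2 m, g m = n & close m (n, q.1, q.2)) \/
   [/\ (forall m, g m <> n), `|q.1%:R / n%:R - p.1| <= n%:R^-1 &
       `|q.2%:R / n%:R - p.2| <= n%:R^-1]].
have /choice[q hq] n : exists q, fits n q.
  have [[m gmn]|ng] := pselect (exists m, g m = n).
    exists ((t m).1.2, (t m).2) => n0; have h : close m (n, (t m).1.2, (t m).2).
      by move: (ht m); rewrite -gmn /g; case: (t m) => -[].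
    by split; [case: h | left; exists m].
  have [n0|n0] := posnP n; first by exists (0, 0)%N; rewrite /fits n0.
  case: sq; rewrite /= !in_itv /= => sq1 sq2.
  have [i hi di] := grid_approx sq1 n0; have [j hj dj] := grid_approx sq2 n0.
  by exists (i, j) => _; split => //; right; split => // m gmn; apply: ng; exists m.
have near_close (M : nat) : \forall n \near \oo,
    `|(q n).1%:R / n%:R - p.1| <= M.+1%:R^-1 /\
    `|(q n).2%:R / n%:R - p.2| <= M.+1%:R^-1.
  near=> n; have n0 : (0 < n)%N by near: n; exact: nbhs_infty_gt.
  have le_inv m : (M <= m)%N -> m.+1%:R^-1 <= M.+1%:R^-1 :> R.
    by move=> Mm; rewrite lef_pV2 ?posrE // ler_nat.
  have [_ [[m gmn [_ _ d1 d2 _]]|[_ d1 d2]]] := hq n n0.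
    have /le_inv h : (M <= m)%N.
      by move: m gmn {d1 d2}; near: n; exact: near_index_ge.
    by split; [exact: le_trans d1 h | exact: le_trans d2 h].
  have h : n%:R^-1 <= M.+1%:R^-1 :> R.
    have Mn : (M < n)%N by near: n; exact: nbhs_infty_gt.
    by rewrite lef_pV2 ?posrE ?ltr0n // ler_nat.
  by split; [exact: le_trans d1 h | exact: le_trans d2 h].
have range n : (0 < n)%N -> (1 <= (q n).1 <= n)%N /\ (1 <= (q n).2 <= n)%N.
  by move/hq => [].
have cvq : (fun n => ((q n).1%:R / n%:R, (q n).2%:R / n%:R) : R * R) @ \oo --> p.
  case: p {sq ab rare close ht hq fits} near_close => x y /= near_close.
  have small (e : R) : 0 < e -> exists M : nat, M.+1%:R^-1 <= e.
    move=> e0; have [M _ hM] := near_infty_natSinv_lt (PosNum e0).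
    by exists M; apply/ltW/(hM M) => /=.
  apply: (@cvg_pair _ _ _ _ (nbhs x) (nbhs y)); apply/cvgrPdist_le => e /small[M hM];
    by apply: filterS (near_close M) => n [d1 d2]; rewrite distrC (le_trans _ hM).
have := rare _ _ range cvq; apply/negP; rewrite -leNgt.
apply: lee_of_real_lt => c /uc[M hM].
apply: limn_esup_ge => N; have [N' _ hN'] := near_index_ge g M.
  (* The triple used at size [n] may belong to an index [m] other than [maxn N'.+1 N], but [n]
     beyond [N'] forces [M <= m], hence [c <= u m]. *)
  pose n := g (maxn N'.+1 N).
  have nN : (maxn N'.+1 N <= n)%N by exact: gm.
  have n0 : (0 < n)%N by lia.
  exists n; first lia.
  have [_ [[m gmn [_ _ _ _ um]]|[/(_ (maxn N'.+1 N))//]]] := hq n n0.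
  rewrite lee_fin; apply: le_trans um; apply: hM.
  by apply: (hN' n) gmn => /=; lia.
Unshelve. all: by end_near. Qed.

(** This will make the supremum and infimum of a fibre good; each of the two approximations gets
    half of [eps]. *)
Lemma abundant_closure (x y : R) :
  (forall eps : R, 0 < eps -> exists2 z, `|z - y| <= eps & abundant (x, z)) ->
  abundant (x, y).
Proof.
move=> h eps c N e0 cL.
have e20 : 0 < eps / 2 by lra.
have [z zy az] := h _ e20.
have [n [i [j [Nn ij di dj hc]]]] := az (eps / 2) c N e20 cL.
exists n, i, j; split => //=; first by move: di => /=; lra.
by have := ler_distD z (j%:R / n%:R) y; move: dj => /=; lra.
Qed.

End Abundance.

End GoodRegion.

(** * Padding and vertical fibres for sum-indecomposable patterns *)

Section SumIndecomposableFibres.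
Variables (R : realType) (k : nat) (tau : 'S_k).
Hypotheses (ind : sum_indecomposable tau) (k_gt1 : (1 < k)%N).

(** The threshold [c] is raised to a positive [c0], the maximum with 1/2, still below a growth rate
    that is at least 1. The gap from [c0] to [d] then pays for the factors [C] of the padding
    blocks. *)
Lemma growth_slack (c : R) : (c%:E < growth_rate R tau)%E ->
  exists c0 d C : R, [/\ c <= c0, 0 < c0 < d, (d%:E < growth_rate R tau)%E, 0 < C &
    forall n, d ^+ n <= C * #|avoiders tau n|%:R].
Proof.
move=> cL; have c0L : ((Num.max c 2^-1)%:E < growth_rate R tau)%E.
  rewrite EFin_max gt_max cL /=; apply: lt_le_trans (growth_rate_ge1 _ _ k_gt1).
  by rewrite lte_fin; lra.
have c0 : 0 < Num.max c 2^-1 by rewrite lt_max; apply/orP; right; lra.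
have [d cd dL] := ereal_real_between c0L.
have [|||C C0 hC] := @lt_lim_root_geometric R (fun n => #|avoiders tau n|) _ _ d _ dL.
- exact: card_avoiders_gt0.
- exact: card_avoidersD.
- exact: le_trans (ltW c0) (ltW cd).
by exists (Num.max c 2^-1), d, C; split; rewrite ?le_max ?lexx // c0.
Qed.

Lemma ratio_dist (u x N e : R) : 0 < N ->
  (`|u / N - x| <= e) = (`|u - x * N| <= e * N).
Proof.
move=> N0; have -> : u / N - x = (u - x * N) / N by rewrite mulrBl mulfK // gt_eqF.
by rewrite normrM normfV (gtr0_norm N0) ler_pdivrMr.
Qed.

Lemma abundant_diag (x : R) : 0 <= x <= 1 -> abundant tau (x, x).
Proof.
move=> /andP[x0 x1] eps c N e0 /growth_slack[c0 [d [C [cc0 /andP[c00 c0d] dL C0 hC]]]].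
have cd : 0 <= c0 < d by rewrite ltW.
(* At total size [n.+1] the two blocks cost [C] each and the inserted point costs [c0]; the last
   condition makes one grid step at most [eps]. *)
have [n [nN cn en]] : exists n : nat,
    [/\ (N <= n)%N, C * C * c0 * c0 ^+ n <= d ^+ n & eps^-1 <= n%:R].
  near \oo => n; exists n; split; near: n;
    [exact: nbhs_infty_ge | exact: geometric_dominated | exact: nbhs_infty_ger].
have xn0 : 0 <= x * n%:R by rewrite mulr_ge0.
have [m m1 m2] := nat_floor xn0.
have mn : (m <= n)%N by rewrite -(ler_nat R) (le_trans m1) // ler_piMl.
have [m' nE] : exists m', n = (m + m')%N by exists (n - m)%N; rewrite subnKC.
have NE : (m + 1 + m' = n.+1)%N by rewrite nE addn1.
have dist : `|m.+1%:R / n.+1%:R - x| <= eps.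
  rewrite ratio_dist // -!natr1 (@le_trans _ _ 1) //.
    by rewrite ler_norml; apply/andP; split; lra.
  have : 1 <= eps * n%:R by rewrite -ler_pdivrMl // mulr1.
  by rewrite mulrDr mulr1; lra.
exists n.+1, m.+1, m.+1; split => //; first exact: leqW.
apply: le_trans cc0 _; rewrite card_root_geE ?(ltW c00) //.
rewrite -(ler_pM2l (mulr_gt0 C0 C0)).
apply: le_trans (_ : d ^+ n <= _); first by rewrite exprS mulrA.
have d0 : 0 <= d by lra.
rewrite {1}nE exprD; apply: (le_trans (ler_pM _ _ (hC m) (hC m'))); rewrite ?exprn_ge0 //.
rewrite mulrACA ler_pM2l ?mulr_gt0 // -natrM ler_nat -NE.
exact: card_avoiders_at_diag.
Unshelve. all: by end_near. Qed.

(* The point (x, x + t (y - x)) lies on the segment from (x, x) to (x, y); it is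
   reached by padding a permutation through (x, y) with blocks of relative sizes
   x (1 - t) below and (1 - x) (1 - t) above. *)
Lemma abundant_segment (x y t : R) : 0 <= x <= 1 -> 0 <= y <= 1 -> 0 < t <= 1 ->
  abundant tau (x, y) -> abundant tau (x, x + t * (y - x)).
Proof.
move=> /andP[x0 x1] /andP[y0 y1] /andP[t0 t1] ab eps c N e0.
move=> /growth_slack[c0 [d [C [cc0 /andP[c00 c0d] dL C0 hC]]]].
have cd : 0 <= c0 < d by rewrite ltW.
have e20 : 0 < eps / 2 by lra.
have [N1 _ hN1] := geometric_dominated (C * C) cd.
(* Error budget in grid steps: rounding the block sizes shifts the position by at most 1 and the
   value by at most 1 + 2, so 3 steps must fit into half of [eps]. *)
have [N2 _ hN2] := nbhs_infty_ger (3 / (eps / 2)).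
have [n [i [j [nN [hi hj] di dj db]]]] := ab _ d (N + N1 + N2)%N e20 dL.
have n0 : (0 < n)%N by move: hi; clear; lia.
have n0' : 0 < n%:R :> R by rewrite ltr0n.
have en : 3 <= eps / 2 * n%:R.
  by rewrite mulrC -ler_pdivrMr //; apply: (hN2 n); rewrite /= (leq_trans _ nN) // leq_addl.
rewrite /= !ratio_dist // in di dj.
(* The total padding relative to [n]: since [1 + s = 1 / t], the core occupies the fraction [t] of
   the whole, up to rounding. *)
pose s := (1 - t) / t; have s0 : 0 <= s by rewrite divr_ge0 ?subr_ge0 // ltW.
have ts : t * s = 1 - t by rewrite /s mulrC divfK // gt_eqF.
have h1 : 0 <= x * s * n%:R by rewrite mulr_ge0 // mulr_ge0.
have h2 : 0 <= (1 - x) * s * n%:R.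
  by rewrite mulr_ge0 // mulr_ge0 // subr_ge0.
have [m1 l1 u1] := nat_floor h1; have [m2 l2 u2] := nat_floor h2.
have NE : (m1 + n + m2)%:R = m1%:R + n%:R + m2%:R :> R by rewrite !natrD.
have N0 : 0 < (m1 + n + m2)%:R :> R by rewrite ltr0n; move: n0; clear; lia.
have nleN : eps * n%:R <= eps * (m1 + n + m2)%:R.
  by rewrite ler_pM2l // ler_nat; clear; lia.
pose e1 := x * s * n%:R - m1%:R; pose e2 := (1 - x) * s * n%:R - m2%:R.
have [e10 e11] : 0 <= e1 /\ e1 <= 1 by split; rewrite /e1; lra.
have [e2_0 e21] : 0 <= e2 /\ e2 <= 1 by split; rewrite /e2; lra.
have [p0 p1] : 0 <= (1 - x) * e1 /\ (1 - x) * e1 <= 1.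
  by split; [rewrite mulr_ge0 //; lra | rewrite mulr_ile1 //; lra].
have [q0 q1] : 0 <= x * e2 /\ x * e2 <= 1.
  by split; [rewrite mulr_ge0 | rewrite mulr_ile1].
have r2 : `|(y - x) * (t * (e1 + e2))| <= 2.
  rewrite normrM -[2]mul1r ler_pM //.
    by rewrite ler_norml; apply/andP; split; lra.
  rewrite ger0_norm; last by rewrite mulr_ge0 //; lra.
  by rewrite -[2]mul1r ler_pM //; lra.
move: di dj r2; rewrite !ler_norml => /andP[di1 di2] /andP[dj1 dj2] /andP[r1 r2].
exists (m1 + n + m2)%N, (m1 + i)%N, (m1 + j)%N; split.
- by move: nN; clear; lia.
- by split; [move: hi | move: hj]; clear; lia.
- rewrite /= ratio_dist // (le_trans _ nleN) // NE natrD.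
  have -> : m1%:R + i%:R - x * (m1%:R + n%:R + m2%:R) =
            - ((1 - x) * e1) + x * e2 + (i%:R - x * n%:R).
    by rewrite /e1 /e2; ring.
  by rewrite ler_norml; apply/andP; split; lra.
- rewrite /= ratio_dist // (le_trans _ nleN) // NE natrD.
  have -> : m1%:R + j%:R - (x + t * (y - x)) * (m1%:R + n%:R + m2%:R) =
    - ((1 - x) * e1) + x * e2 + (j%:R - y * n%:R) + (y - x) * (t * (e1 + e2)).
    rewrite /e1 /e2; have -> : t * (x * s * n%:R - m1%:R +
      ((1 - x) * s * n%:R - m2%:R)) = t * s * n%:R - t * (m1%:R + m2%:R) by ring.
    by rewrite ts; ring.
  by rewrite ler_norml; apply/andP; split; lra.
apply: le_trans cc0 _; rewrite card_root_geE ?(ltW c00) //; last by rewrite -(ltr0n R).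
rewrite card_root_geE // in db; last lra.
rewrite -(ler_pM2l (mulr_gt0 C0 C0)).
apply: le_trans (_ : d ^+ (m1 + n + m2) <= _); first
  by apply: hN1; move: nN; clear; rewrite /=; lia.
have d0 p : 0 <= d ^+ p by rewrite exprn_ge0 //; lra.
(* The outer powers are bounded by [C] times the block counts, the middle one directly by the count
   through [(i, j)], so only [C * C] is lost. *)
rewrite !exprD.
apply: (le_trans (ler_pM _ _ (ler_pM _ _ (hC m1) db) (hC m2))); rewrite ?mulr_ge0 //.
rewrite [leLHS](_ : _ = C * C * (#|avoiders tau m1| *
  #|avoiders_at tau n i j| * #|avoiders tau m2|)%:R); last by rewrite !natrM; ring.
rewrite ler_pM2l ?mulr_gt0 // ler_nat.
apply: leq_trans (card_avoiders_atDr ind _ _ _ _).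
by rewrite leq_mul2r card_avoiders_atDl ?orbT.
Qed.

Lemma good_diag (x : R) : 0 <= x <= 1 -> good_region tau (x, x).
Proof.
move=> x01; apply: abundant_good; last exact: abundant_diag.
by split; rewrite /= in_itv.
Qed.

(** A point [w] below [x] lies on the segment from [x] to [y], one above [x] on the segment from [x]
    to [z]; both segments are good. *)
Lemma good_fibre_interval (x : R) : is_interval [set y | good_region tau (x, y)].
Proof.
have towards y t : good_region tau (x, y) -> 0 < t <= 1 ->
    good_region tau (x, x + t * (y - x)).
  move=> gy t01; have [[]] := gy; rewrite /= !in_itv /= => x01 y01 _.
  apply: abundant_good; last exact/abundant_segment/good_abundant.
  by split; rewrite /= in_itv //=; apply/andP; split; nra.
move=> y z gy gz w /andP[yw wz] /=.
have ratio v : good_region tau (x, v) -> 0 < (w - x) / (v - x) <= 1 ->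
    good_region tau (x, w).
  move=> gv t01; have := towards v _ gv t01.
  (* For [v = x] the quotient would be 0, by the convention [0^-1 = 0], against its positivity. *)
  have vx : v - x != 0.
    by apply: contraTneq t01 => ->; rewrite invr0 mulr0 ltxx.
  by rewrite divfK // addrC subrK.
have [wx|xw|->] := ltgtP w x.
- by apply: (ratio y gy); rewrite -mulrNN -invrN !opprB divr_gt0 ?ler_pdivrMr; lra.
- by apply: (ratio z gz); rewrite divr_gt0 ?ler_pdivrMr; lra.
- by have [[]] := gy; rewrite /= in_itv /= => x01 _ _; exact: good_diag.
Qed.

End SumIndecomposableFibres.

(** * Reflection of the good region and fibres for arbitrary patterns *)

Section Fibres.
Variable R : realType.

Lemma good_region_compl (k : nat) (tau : 'S_k) (x y : R) :
  good_region (perm_compl tau) (x, y) -> good_region tau (x, 1 - y).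
Proof.
move=> gy; have ab := good_abundant gy.
have [[]] := gy; rewrite /= !in_itv /= => x01 /andP[y0 y1] _.
apply: abundant_good; first by split; rewrite /= in_itv //=; apply/andP; split; lra.
move=> eps c N e0 cL; have e20 : 0 < eps / 2 by lra.
have [N1 _ hN1] := nbhs_infty_ger (eps / 2)^-1.
rewrite -growth_rate_compl in cL.
have [n [i [j [Nn [hi hj] di dj hc]]]] := ab _ _ (N + N1)%N e20 cL.
have n0 : (0 < n)%N by move: hi; clear; lia.
have n0' : 0 < n%:R :> R by rewrite ltr0n.
exists n, i, (n.+1 - j)%N; split => //.
- by move: Nn; clear; lia.
- by split => //; move: hj; clear; lia.
- by move: di => /=; lra.
(* With 1-based values the reflection sends [j] to [n + 1 - j], which misses [1 - j / n] by [1 / n];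
   this uses the other half of [eps]. *)
- have ninv : n%:R^-1 <= eps / 2.
    rewrite -[leRHS]invrK lef_pV2 ?posrE ?invr_gt0 //.
    by apply: (hN1 n); rewrite /= (leq_trans _ Nn) // leq_addl.
  rewrite /= natrB; last by move: hj; clear; lia.
  have -> : (n.+1%:R - j%:R) / n%:R - (1 - y) = n%:R^-1 - (j%:R / n%:R - y).
    by rewrite -natr1; field; rewrite gt_eqF.
  have nV0 : 0 <= n%:R^-1 :> R by rewrite invr_ge0.
  by move: dj; rewrite /= !ler_norml => /andP[? ?]; apply/andP; split; lra.
rewrite -(card_avoiders_at_compl i tau); last by move: hj; clear; lia.
by rewrite subKn //; move: hj; clear; lia.
Qed.

Lemma good_fibre (k : nat) (tau : 'S_k) (x : R) : 0 <= x <= 1 ->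
  [set y | good_region tau (x, y)] !=set0 /\
  is_interval [set y | good_region tau (x, y)].
Proof.
move=> x01; have [k1|k1] := leqP k 1.
  (* Here the growth rate is 0, so every threshold is negative and any grid point near [(x, y)]
     reaches it: the whole square is good. *)
  have all_good y : 0 <= y <= 1 -> good_region tau (x, y).
    move=> y01; apply: abundant_good; first by split; rewrite /= in_itv.
    move=> eps c N e0; rewrite growth_rate_trivial // lte_fin => c0.
    have [N1 _ hN1] := nbhs_infty_ger eps^-1.
    pose n := (N + N1).+1.
    have ninv : n%:R^-1 <= eps.
      rewrite -[leRHS]invrK lef_pV2 ?posrE ?invr_gt0 //.
      by apply: (hN1 n); rewrite /= leqW // leq_addl.
    have [//|i hi di] := @grid_approx R x n x01.
    have [//|j hj dj] := @grid_approx R y n y01.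
    exists n, i, j; split => //; first by rewrite leqW // leq_addr.
    - exact: le_trans di ninv.
    - exact: le_trans dj ninv.
    - exact: le_trans (ltW c0) (card_root_ge0 _ _ _).
  split; first by exists 0; apply: all_good; rewrite lexx ler01.
  move=> y z [[_ +] _] [[_ +] _] w /andP[yw wz]; rewrite /= !in_itv /=.
  by move=> /andP[y0 _] /andP[_ z1]; apply: all_good; apply/andP; split; lra.
case: (sum_indecomposable_dichotomy tau) => ind.
  by split; [exists x; exact: good_diag | exact: good_fibre_interval].
split.
  by exists (1 - x); apply: good_region_compl; exact: good_diag.
have flip y : good_region tau (x, y) -> good_region (perm_compl tau) (x, 1 - y).
  by move=> gy; apply: good_region_compl; rewrite perm_complK.
move=> y z gy gz w /andP[yw wz] /=; rewrite -[w](subKr 1).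
(* Reflection reverses the order, so [z] and [y] trade places as endpoints. *)
apply: good_region_compl; apply: (good_fibre_interval ind k1 (flip _ gz) (flip _ gy)).
by apply/andP; split; lra.
Qed.

End Fibres.

Theorem theorem2p13 (R : realType) (k : nat) (tau : 'S_k) :
  (good_region tau : set (R * R)) =
  [set p : R * R | unit_square p /\ r_down tau p.1 <= p.2 <= r_up tau p.1].
Proof.
have bounds (x y : R) : good_region tau (x, y) -> 0 <= y <= 1.
  by move=> [[_ +] _]; rewrite /= in_itv.
have ub (x : R) : has_ubound [set y | good_region tau (x, y)].
  by exists 1 => y /bounds/andP[].
have lb (x : R) : has_lbound [set y | good_region tau (x, y)].
  by exists 0 => y /bounds/andP[].
apply/seteqP; split => -[x y] /=.
  move=> gy; split; first by case: gy.
  by apply/andP; split; [apply: ge_inf | apply: ub_le_sup].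
move=> [sq /andP[dy yu]].
have x01 : 0 <= x <= 1 by case: sq; rewrite /= in_itv.
(* On an empty fibre [sup] and [inf] would take the default value 0; nonemptiness makes them limits
   of good points, and closedness then makes them good. *)
have [ne itv] := good_fibre tau x01.
have closed_fibre z : 0 <= z <= 1 ->
    (forall eps, 0 < eps -> exists2 w, `|w - z| <= eps & good_region tau (x, w)) ->
    good_region tau (x, z).
  move=> z01 h; apply: abundant_good; first by split; rewrite /= in_itv.
  by apply: abundant_closure => eps /h[w wz /good_abundant]; exists w.
have [w0 gw0] := ne; have /andP[w00 w01] := bounds _ _ gw0.
have up_ge : w0 <= r_up tau x by apply: ub_le_sup.
have down_le : r_down tau x <= w0 by apply: ge_inf.
have gup : good_region tau (x, r_up tau x).
  apply: closed_fibre.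
    rewrite (le_trans w00) //=; apply: ge_sup => //.
    by move=> w /bounds/andP[].
  move=> eps e0; have [w gw hw] := sup_adherent e0 (conj ne (ub x)).
  have wle : w <= r_up tau x by apply: ub_le_sup.
  by exists w => //; rewrite ler_norml /r_up in wle *; apply/andP; split; lra.
have gdown : good_region tau (x, r_down tau x).
  apply: closed_fibre.
    rewrite (le_trans _ w01) // andbT; apply: lb_le_inf => //.
    by move=> w /bounds/andP[].
  move=> eps e0; have [w gw hw] := inf_adherent e0 (conj ne (lb x)).
  have wge : r_down tau x <= w by apply: ge_inf.
  by exists w => //; rewrite ler_norml /r_down in wge *; apply/andP; split; lra.
by apply: (itv _ _ gdown gup); rewrite dy yu.
Qed.
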